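(* Let $I$ be a homogeneous ideal of $S=\mathbb{K}[x_1,\dots,x_l]$. Then the following facts are equivalent: (1) the graded ring $S/I$ has the weak Lefschetz property; (2) there exists an element $\ell\in (S/I)_1$ such that the multiplication map $\times \ell\colon (S/I)_i\to (S/I)_{i+1}$, $f\mapsto \ell f$, has full rank for every $0\le i\le \operatorname{reg}(I)-1$.
   Context: $\mathbb{K}$ is a field of characteristic $0$ and $S=\mathbb{K}[x_1,\dots,x_l]$ has the standard grading. A graded ring $R=\bigoplus_{i\ge 0}R_i$ over $\mathbb{K}$ with $\dim_{\mathbb{K}}R_i<\infty$ has the weak Lefschetz property (WLP) if there exists $\ell\in R_1$ such that for every $i\ge 0$ the multiplication map $\times\ell\colon R_i\to R_{i+1}$ has full rank (that is, is injective or surjective). The Castelnuovo-Mumford regularity $\operatorname{reg}(I)$ of a homogeneous ideal $I$ is the maximum of the numbers $d_i-i$, where $d_i=\max\{j\mid \beta_{i,j}(I)\neq 0\}$ and $\beta_{i,j}(I)$ are the graded Betti numbers of $I$ over $S$. Artinianity of $S/I$ is not assumed. *)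

(* Defs.v *)
From HB Require Import structures.
From mathcomp Require Import all_boot all_order all_algebra.
From mathcomp.multinomials Require Import mpoly.

Set Implicit Arguments.
Unset Strict Implicit.
Unset Printing Implicit Defensive.

Import Order.TTheory GRing.Theory Num.Theory.

Local Open Scope ring_scope.

(* Ideals are Prop-valued predicates: the library's [idealr] structure covers
   only proper ideals with decidable membership. *)
Definition is_ideal (R : comNzRingType) (I : R -> Prop) : Prop :=
  [/\ I 0,
      forall f g, I f -> I g -> I (f + g)
    & forall a f, I f -> I (a * f)].

Definition is_homogeneous_ideal (K : fieldType) (l : nat)
    (I : {mpoly K[l]} -> Prop) : Prop :=
  is_ideal I /\ forall f, I f -> forall d, I (pihomog mdeg d f).

(* S/I is handled as S modulo the congruence below; since I is homogeneous,
   its component of degree i consists of the classes of the elements of S_i. *)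
Definition eq_mod_ideal (R : comNzRingType) (I : R -> Prop) (f g : R) : Prop :=
  I (f - g).

(* In the next three definitions, [ell] is a form of degree 1 representing an
   element of (S/I)_1. *)
Definition mul_injective (K : fieldType) (l : nat) (I : {mpoly K[l]} -> Prop)
    (ell : {mpoly K[l]}) (i : nat) : Prop :=
  forall f g : {mpoly K[l]}, f \is i.-homog -> g \is i.-homog ->
    eq_mod_ideal I (ell * f) (ell * g) -> eq_mod_ideal I f g.

Definition mul_surjective (K : fieldType) (l : nat) (I : {mpoly K[l]} -> Prop)
    (ell : {mpoly K[l]}) (i : nat) : Prop :=
  forall h : {mpoly K[l]}, h \is i.+1.-homog ->
    exists2 f : {mpoly K[l]}, f \is i.-homog & eq_mod_ideal I (ell * f) h.

Definition mul_full_rank (K : fieldType) (l : nat) (I : {mpoly K[l]} -> Prop)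
    (ell : {mpoly K[l]}) (i : nat) : Prop :=
  mul_injective I ell i \/ mul_surjective I ell i.

Definition weak_lefschetz (K : fieldType) (l : nat)
    (I : {mpoly K[l]} -> Prop) : Prop :=
  exists2 ell : {mpoly K[l]}, ell \is 1.-homog &
    forall i : nat, mul_full_rank I ell i.

(* Data  ... -> F_2 -> F_1 -> F_0 -> S  of graded free modules, where
   F_i = \bigoplus_p S(- shift p) is the module of row vectors 'rV_(rk i), and
   matrices act on the right. Natural-number shifts suffice: the generators in
   a minimal free resolution of an ideal of S have nonnegative degrees. *)
Record free_seq (K : fieldType) (l : nat) := FreeSeq {
  rk : nat -> nat;
  shift : forall i, 'I_(rk i) -> nat;
  aug : 'cV[{mpoly K[l]}]_(rk 0);
  diff : forall i, 'M[{mpoly K[l]}]_(rk i.+1, rk i)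
}.

(* Maps of degree 0: a basis element of degree a may have along one of degree b
   only a coefficient of degree a - b. *)
Definition graded_free_seq (K : fieldType) (l : nat) (F : free_seq K l) : Prop :=
  (forall p, aug F p 0 \is (shift p).-homog) /\
  (forall i p q, if (shift q <= shift p)%N
                 then diff F i p q \is (shift p - shift q).-homog
                 else diff F i p q == 0).

Definition resolves (K : fieldType) (l : nat) (I : {mpoly K[l]} -> Prop)
    (F : free_seq K l) : Prop :=
  [/\ forall f, I f <-> exists v : 'rV_(rk F 0), f = (v *m aug F) 0 0,
      forall v : 'rV_(rk F 0),
        v *m aug F = 0 <-> exists w, v = w *m diff F 0
    & forall i (v : 'rV_(rk F i.+1)),
        v *m diff F i = 0 <-> exists w, v = w *m diff F i.+1].

(* The image of F_(i+1) lies in (x_1, ..., x_l) F_i. *)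
Definition minimal_free_seq (K : fieldType) (l : nat) (F : free_seq K l) : Prop :=
  forall i p q, (diff F i p q)@_0%MM = 0.

Definition minimal_graded_free_resolution (K : fieldType) (l : nat)
    (I : {mpoly K[l]} -> Prop) (F : free_seq K l) : Prop :=
  [/\ graded_free_seq F, resolves I F & minimal_free_seq F].

(* The graded Betti number beta_(i,j)(I) when F is a minimal graded free
   resolution of I; it does not depend on the choice of F. *)
Definition betti (K : fieldType) (l : nat) (F : free_seq K l) (i j : nat) : nat :=
  #|[pred p : 'I_(rk F i) | shift p == j]|.

(* d = max {j | beta_(i,j) <> 0} *)
Definition is_max_degree (K : fieldType) (l : nat) (F : free_seq K l)
    (i d : nat) : Prop :=
  betti F i d <> 0%N /\ forall j, betti F i j <> 0%N -> (j <= d)%N.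

(* [regularity I r] means reg(I) = r. The value [None] stands for -oo, the
   maximum of the empty set: it occurs exactly for I = 0, which has no nonzero
   Betti number. *)
Definition regularity (K : fieldType) (l : nat) (I : {mpoly K[l]} -> Prop)
    (r : option int) : Prop :=
  exists2 F : free_seq K l, minimal_graded_free_resolution I F &
    match r with
    | Some m =>
        (exists i d : nat, is_max_degree F i d /\ m = d%:Z - i%:Z) /\
        (forall i d : nat, is_max_degree F i d -> d%:Z - i%:Z <= m)
    | None => forall i d : nat, ~ is_max_degree F i d
    end.

(* i <= r - 1 *)
Definition le_reg_pred (i : nat) (r : option int) : Prop :=
  match r with
  | Some m => i%:Z <= m - 1
  | None => False
  end.

(* Main.v *)
Require Import Defs.
From HB Require Import structures.
From mathcomp Require Import all_boot all_order all_algebra.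
From mathcomp Require Import ring zify.
From Stdlib Require Import Classical ClassicalEpsilon.
From mathcomp.multinomials Require Import mpoly.

Set Implicit Arguments.
Unset Strict Implicit.
Unset Printing Implicit Defensive.

Import Order.TTheory GRing.Theory Num.Theory.

Local Open Scope ring_scope.

(** Only the passage from finitely many degrees to all degrees has content.
Write S for the polynomial ring, m for its irrelevant ideal and reg for the
regularity of I. Let ell have full rank in all degrees below reg, and let
ell_t = ell + t x_1 + ... + t^l x_l, for t in K, be the curve of linear forms
[moment_form], which passes through ell at t = 0. Each of the following
properties holds for all t outside the roots of some nonzero polynomial, so
they hold together for some t, because K is infinite.

- In each of the finitely many degrees i < reg, ell_t has full rank: the rank
  of a matrix with polynomial entries in t is lower semicontinuous
  ([rank_lower_semicontinuous], [generic_full_rank]).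

- If ell_t g lies in I, then g lies in the saturation of I
  ([generic_nonzerodivisor]). This is proved for all ideals J of S by
  Noetherian induction. If J contains a product f g but neither factor, then
  J : f and J + (f) are strictly larger than J, and the claim passes from these
  two ideals to J. Otherwise J is prime or the unit ideal; when it does not
  contain m, it contains ell_t only for t among the roots of a nonzero
  polynomial, and when it does, the claim is trivial. The induction itself
  rests on Dickson's lemma ([dickson], [noetherian_ind]).

It remains to see that ell_t is injective in the degrees i >= reg, and for this
that I and its saturation agree there: a form f of degree d >= reg with x_j f in
I for all j lies in I ([socle_mem], [regularity_socle]). Multiplication by f,
viewed as a map from the degree 0 term of the Koszul complex of x_1, ..., x_l to
S, lifts to a map from the Koszul complex to the resolution F of I, whose last
component sends the generator of the top term to an element of F_(l-1) of
degree d + l. As the degrees of the generators of F_(l-1) are at most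
reg + l - 1 < d + l, this element has coefficients in m, so that the last
component is a Koszul coboundary. Exactness of the Koszul cochain complex below
the top degree turns this, by descending induction, into a homotopy which shows
that f is in the image of F_0, that is, in I ([koszul_lift]). The exactness
needed is explicit in characteristic 0: the contraction with partial
derivatives is a homotopy between 0 and a multiplication by a positive integer
([koszul_homotopy]), by Euler's formula. *)

(** * Homogeneous polynomials with shifted degrees *)

(** [f] is an element of degree [b] of the graded module S(-a): all its monomials
have degree [b - a]. The zero polynomial always qualifies, and it is the only
one that does when [b < a]. *)
Definition shifted_homog (K : fieldType) (l : nat) (a b : nat)
    (f : {mpoly K[l]}) : Prop :=
  forall m, m \in msupp f -> (mdeg m + a = b)%N.

Section ShiftedHomog.
Variables (K : fieldType) (l : nat).
Implicit Types f g : {mpoly K[l]}.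

Lemma shifted_homog0 a b : shifted_homog a b (0 : {mpoly K[l]}).
Proof. by move=> m; rewrite msupp0. Qed.

Lemma shifted_homogD a b f g :
  shifted_homog a b f -> shifted_homog a b g -> shifted_homog a b (f + g).
Proof. by move=> hf hg m /msuppD_le; rewrite mem_cat => /orP[/hf|/hg]. Qed.

Lemma shifted_homogN a b f : shifted_homog a b f -> shifted_homog a b (- f).
Proof. by move=> hf m; rewrite (perm_mem (msuppN f)); apply: hf. Qed.

Lemma shifted_homogB a b f g :
  shifted_homog a b f -> shifted_homog a b g -> shifted_homog a b (f - g).
Proof. by move=> hf /shifted_homogN; apply: shifted_homogD. Qed.

Lemma shifted_homogZ a b c f : shifted_homog a b f -> shifted_homog a b (c *: f).
Proof. by move=> hf m /msuppZ_le; apply: hf. Qed.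

Lemma shifted_homog_sum a b (T : finType) (P : pred T) (F : T -> {mpoly K[l]}) :
  (forall t, P t -> shifted_homog a b (F t)) ->
  shifted_homog a b (\sum_(t | P t) F t).
Proof.
move=> hF; apply: (big_ind (@shifted_homog K l a b)) => //.
  exact: shifted_homog0.
exact: shifted_homogD.
Qed.

Lemma shifted_homogM a b c f g :
  shifted_homog a b f -> shifted_homog c a g -> shifted_homog c b (f * g).
Proof.
move=> hf hg m /msuppM_le/allpairsP[[m1 m2] /= [/hf e1 /hg e2 ->]].
by rewrite mdegD -addnA e2.
Qed.

Lemma shifted_homogX a b i f :
  shifted_homog a b f -> shifted_homog a b.+1 ('X_i * f).
Proof.
move=> hf; apply: shifted_homogM hf => m.
by rewrite msuppX inE => /eqP->; rewrite mdeg1.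
Qed.

Lemma shifted_homog_sign a b n f :
  shifted_homog a b f -> shifted_homog a b ((-1) ^+ n * f).
Proof.
rewrite -signr_odd; case: (odd n); rewrite ?mulN1r ?mul1r //.
exact: shifted_homogN.
Qed.

Lemma shifted_homog_mderiv a b i f :
  shifted_homog a b.+1 f -> shifted_homog a b (mderiv i f).
Proof.
move=> hf m; rewrite mcoeff_msupp mcoeff_deriv => nz.
have /hf : (m + U_(i))%MM \in msupp f.
  by rewrite mcoeff_msupp; apply: contraNneq nz => ->; rewrite mul0rn.
by rewrite mdegD mdeg1 addn1 addSn => -[].
Qed.

Lemma shifted_homogP d f : reflect (shifted_homog 0 d f) (f \is d.-homog).
Proof.
apply: (iffP (dhomogP _ _ _)) => hf m /hf //=; first by rewrite addn0.
by rewrite addn0.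
Qed.

(** Euler's formula. The truncated subtraction is harmless, as [f = 0] when
[b < a]. *)
Lemma euler_homog a b f : shifted_homog a b f ->
  \sum_i 'X_i * mderiv i f = (b - a)%:R *: f.
Proof.
move=> hf; apply/mpolyP => m; rewrite raddf_sum /= mcoeffZ.
have E i : ('X_i * mderiv i f)@_m = (m i)%:R * f@_m.
  have [mi0|mi] := eqVneq (m i) 0%N.
    rewrite mi0 mul0r; apply/eqP; rewrite mcoeff_eq0; apply/negP.
    move=> /msuppM_le/allpairsP[[m1 m2] /=]; rewrite msuppX inE => -[/eqP-> _ E].
    by move: mi0; rewrite E mnmDE mnm1E eqxx.
  have Em : (m = (m - U_(i)) + U_(i))%MM by rewrite submK // lep1mP.
  have -> : ('X_i * mderiv i f)@_m = (mderiv i f)@_(m - U_(i)).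
    by rewrite [in LHS]Em addmC mulrC mcoeffMX.
  rewrite mcoeff_deriv -Em mnmBE mnm1E eqxx subn1 prednK ?lt0n //.
  by rewrite mulr_natl.
rewrite (eq_bigr _ (fun i _ => E i)) -mulr_suml -natr_sum -mdegE.
have [/hf <-|/memN_msupp_eq0 ->] := boolP (m \in msupp f); last by rewrite !mulr0.
by rewrite addnK.
Qed.

End ShiftedHomog.

(** * The Koszul cochain complex *)

Section Koszul.
Variables (K : fieldType) (l : nat).
Local Notation S := {mpoly K[l]}.

(** The sign with which x_j enters the wedge product of x_j with the basis element
indexed by A; the value does not depend on whether [j] lies in [A]. *)
Definition ksign (j : 'I_l) (A : {set 'I_l}) : S :=
  (-1) ^+ #|[set k in A | (k < j)%N]|.

(** The Koszul coboundary, exterior multiplication by the sum of the x_j e_j, on the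
cochains with values in [V]. A cochain assigns a value to each subset of the set
of variables; the cochains of degree i are those supported on the subsets of
cardinality i, but all degrees are treated at once. *)
Definition koszul (V : lmodType S) (phi : {set 'I_l} -> V) (A : {set 'I_l}) : V :=
  \sum_(j in A) (ksign j A * 'X_j) *: phi (A :\ j).

(** The contraction with the sum of the partial derivatives, which lowers the degree
of cochains by one. *)
Definition koszul_dual (phi : {set 'I_l} -> S) (A : {set 'I_l}) : S :=
  \sum_(k | k \notin A) ksign k A * mderiv k (phi (k |: A)).

Lemma ksignU1 (j k : 'I_l) (A : {set 'I_l}) : k \notin A ->
  ksign j (k |: A) = (-1) ^+ (k < j)%N * ksign j A.
Proof.
move=> kA; rewrite /ksign; have [kj|kj] := boolP (k < j)%N.
  have -> : [set i in k |: A | (i < j)%N] = k |: [set i in A | (i < j)%N].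
    apply/setP => i; rewrite !inE.
    by case: eqP => [->|_] /=; rewrite ?kj.
  by rewrite cardsU1 !inE (negPf kA) exprS.
rewrite mul1r; congr (_ ^+ #|pred_of_set _|); apply/setP => i; rewrite !inE.
by case: eqP => [->|_] //=; rewrite (negPf kj) (negPf kA).
Qed.

Lemma ksignD1 (j k : 'I_l) (A : {set 'I_l}) : k \in A ->
  ksign j (A :\ k) = (-1) ^+ (k < j)%N * ksign j A.
Proof.
move=> kA; rewrite -[in RHS](setD1K kA) ksignU1 ?setD11 //.
by rewrite mulrA -signr_addb addbb mul1r.
Qed.

Lemma ksign_sqr j A : ksign j A * ksign j A = 1.
Proof. by rewrite /ksign -expr2 sqrr_sign. Qed.

Lemma ltn_swap_sign (j k : 'I_l) : j != k ->
  (-1) ^+ (k < j)%N = - (-1) ^+ (j < k)%N :> S.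
Proof.
by rewrite -val_eqE /=; case: ltngtP => //= _ _; rewrite ?expr0 ?expr1 ?opprK.
Qed.

Lemma sum_antisym (V : zmodType) (G : 'I_l -> 'I_l -> V) :
  (forall j, G j j = 0) -> (forall j k, j != k -> G j k = - G k j) ->
  \sum_j \sum_k G j k = 0.
Proof.
move=> G0 GN.
pose T := \sum_(j < l) \sum_(k < l | (j < k)%N) G j k.
have E : \sum_j \sum_k G j k = T + \sum_(j < l) \sum_(k < l | (k < j)%N) G j k.
  rewrite -big_split; apply: eq_bigr => j _ /=.
  rewrite (bigID (fun k : 'I_l => (j < k)%N)) /=; congr (_ + _).
  rewrite [LHS](bigD1 j) ?ltnn //= G0 add0r; apply: eq_bigl => k.
  by rewrite -leqNgt ltn_neqAle andbC.
rewrite E; apply/eqP; rewrite addrC addr_eq0 -sumrN.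
rewrite (exchange_big_dep predT) //=; apply/eqP; apply: eq_bigr => j _.
rewrite -sumrN; apply: eq_bigr => k jk; rewrite GN // -val_eqE /=.
by rewrite neq_ltn jk orbT.
Qed.

Lemma koszul_koszul (V : lmodType S) (phi : {set 'I_l} -> V) A :
  koszul (koszul phi) A = 0.
Proof.
pose G (j k : 'I_l) := if [&& j \in A, k \in A & k != j] then
  (ksign j A * 'X_j * (ksign k (A :\ j) * 'X_k)) *: phi (A :\ j :\ k) else 0.
have -> : koszul (koszul phi) A = \sum_j \sum_k G j k.
  rewrite /koszul big_mkcond /=; apply: eq_bigr => j _.
  case: (boolP (j \in A)) => jA; last first.
    by rewrite big1 // => k _; rewrite /G (negPf jA).
  rewrite scaler_sumr big_mkcond /=; apply: eq_bigr => k _.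
  by rewrite /G jA /= !inE andbC; case: ifP => //; rewrite scalerA.
apply: sum_antisym => [j|j k jk]; first by rewrite /G eqxx !andbF.
rewrite /G eq_sym andbCA; case: ifP => [/and3P[kA jA _]|]; last by rewrite oppr0.
have -> : A :\ j :\ k = A :\ k :\ j by apply/setP => i; rewrite !inE andbCA.
rewrite -scaleNr; congr (_ *: _).
rewrite !ksignD1 // (ltn_swap_sign jk); ring.
Qed.

Lemma koszul_linear (V W : lmodType S) (f : {linear V -> W})
    (phi : {set 'I_l} -> V) A :
  f (koszul phi A) = koszul (fun B => f (phi B)) A.
Proof.
by rewrite /koszul linear_sum; apply: eq_bigr => j _; rewrite linearZ.
Qed.

Lemma koszul_polyE (phi : {set 'I_l} -> S) A :
  @koszul S^o phi A = \sum_(j in A) ksign j A * 'X_j * phi (A :\ j).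
Proof. by []. Qed.

Lemma mderiv_ksignX j k A f :
  mderiv k (ksign j A * 'X_j * f) =
  ksign j A * ((j == k)%:R * f + 'X_j * mderiv k f).
Proof.
rewrite -mulrA /ksign -signr_odd; set b := odd _.
have -> : mderiv k ((-1) ^+ b * ('X_j * f)) = (-1) ^+ b * mderiv k ('X_j * f).
  by case: b; rewrite ?mulN1r ?mul1r ?mderivN.
congr (_ * _); rewrite mderivM mderivX mnm1E; congr (_ * _ + _).
case: eqP => [->|_]; rewrite ?scale0r // scale1r.
by rewrite -[X in (X - _)%MM]addm0 [(_ + 0)%MM]addmC addmK mpolyX0.
Qed.

(** On a form of degree e placed at the subset A, the anticommutator of the two
operators is multiplication by e + (l - #|A|). *)
Lemma koszul_homotopy (phi : {set 'I_l} -> S) A :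
  koszul_dual (@koszul S^o phi) A + @koszul S^o (koszul_dual phi) A =
  (\sum_k 'X_k * mderiv k (phi A)) + (l - #|A|)%:R *: phi A.
Proof.
(* the terms that occur, with opposite signs, in both composites *)
pose c j k : S := ksign k A * ksign j (k |: A) * 'X_j *
  mderiv k (phi ((k |: A) :\ j)).
have E1 : koszul_dual (@koszul S^o phi) A =
    \sum_(k | k \notin A) (phi A + 'X_k * mderiv k (phi A)) +
    \sum_(j in A) \sum_(k | k \notin A) c j k.
  rewrite exchange_big -big_split /=; apply: eq_bigr => k kA.
  rewrite koszul_polyE big_setU1 //= mderivD mulrDr; congr (_ + _).
    rewrite setU1K // mderiv_ksignX.
    by rewrite eqxx mul1r ksignU1 // ltnn mul1r mulrA ksign_sqr mul1r.
  rewrite linear_sum /= mulr_sumr; apply: eq_bigr => j jA.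
  rewrite mderiv_ksignX (_ : j == k = false) ?mul0r ?add0r ?mulrA //.
  by apply: contraNF kA => /eqP <-.
have E2 : @koszul S^o (koszul_dual phi) A =
    \sum_(k in A) 'X_k * mderiv k (phi A) -
    \sum_(j in A) \sum_(k | k \notin A) c j k.
  rewrite koszul_polyE -sumrN -big_split /=; apply: eq_bigr => j jA.
  rewrite /koszul_dual (bigD1 j) ?setD11 //= mulrDr setD1K //; congr (_ + _).
    by rewrite ksignD1 // ltnn mul1r mulrACA ksign_sqr mul1r.
  rewrite mulr_sumr -sumrN; apply: eq_big => k.
    rewrite !inE negb_and negbK; case: eqP => [->|_]; last by rewrite andbT.
    by rewrite jA.
  rewrite !inE negb_and negbK => /andP[kA kj]; rewrite (negPf kj) /= in kA.
  have jk : j != k by rewrite eq_sym.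
  have -> : k |: A :\ j = (k |: A) :\ j.
    by apply/setP => i; rewrite !inE; case: (eqVneq i k) => // ->; rewrite kj.
  rewrite /c ksignU1 // ksignD1 // (ltn_swap_sign jk); ring.
rewrite E1 E2 addrACA subrr addr0 big_split /= sumr_const.
have -> : #|[pred k | k \notin A]| = (l - #|A|)%N.
  by have E := cardC (mem A); rewrite card_ord in E; rewrite -[LHS](addKn #|A|) E.
rewrite [in RHS](bigID (mem A)) /= scaler_nat -addrA addrC; congr (_ + _).
by rewrite addrC.
Qed.
End Koszul.

Section KoszulExact.
Variables (K : fieldType) (l : nat).
Hypothesis charK0 : [pchar K] =i pred0.
Local Notation S := {mpoly K[l]}.

(** Exactness of the Koszul cochain complex. Over the subset A, the module S(-s) is
taken in degree d + #|A|, so that the eigenvalue of the anticommutator is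
d + l - s for every A. It is positive when d exceeds s - l, the degree of the
top cohomology. *)
Lemma koszul_exact_poly s d (phi : {set 'I_l} -> S) : (s < d + l)%N ->
  (forall A : {set 'I_l}, shifted_homog s (d + #|A|) (phi A)) ->
  (forall A, @koszul K l S^o phi A = 0) ->
  exists psi : {set 'I_l} -> S,
    (forall A : {set 'I_l}, shifted_homog s (d + #|A|) (psi A)) /\
    (forall A, phi A = @koszul K l S^o psi A).
Proof.
move=> ltsd hphi phi0; pose c : K := (d + l - s)%:R.
have nzc : c != 0 by rewrite (proj1 (pcharf0P _) charK0) -lt0n subn_gt0.
exists (fun A => c^-1 *: koszul_dual phi A); split=> A.
  apply/shifted_homogZ/shifted_homog_sum => k kA.
  apply/shifted_homog_sign/shifted_homog_mderiv.
  by have := hphi (k |: A); rewrite cardsU1 kA add1n addnS.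
have := koszul_homotopy phi A.
have -> : koszul_dual (@koszul K l S^o phi) A = 0.
  by rewrite /koszul_dual big1 // => k _; rewrite phi0 mderiv0 mulr0.
rewrite add0r (euler_homog (hphi A)) -scalerDl -natrD => E.
rewrite koszul_polyE.
transitivity (c^-1 *: @koszul K l S^o (koszul_dual phi) A); last first.
  by rewrite koszul_polyE scaler_sumr; apply: eq_bigr => j _; rewrite scalerAr.
rewrite E; have [->|nz] := eqVneq (phi A) 0; first by rewrite !scaler0.
have /hphi lesd := mlead_supp nz.
rewrite scalerA (_ : (_ + _)%:R = c) ?mulVf ?scale1r //; congr _%:R.
by have := max_card A; rewrite card_ord; lia.
Qed.

Lemma koszul_coord n (Phi : {set 'I_l} -> 'rV[S]_n) A p :
  koszul Phi A 0 p = @koszul K l S^o (fun B => Phi B 0 p) A.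
Proof.
by rewrite /koszul summxE; apply: eq_bigr => j _; rewrite mxE.
Qed.

Lemma koszul_mulmx m n (D : 'M[S]_(m, n)) (Phi : {set 'I_l} -> 'rV[S]_m) A :
  koszul Phi A *m D = koszul (fun B => Phi B *m D) A.
Proof. exact: (koszul_linear (mulmxr D)). Qed.

Lemma koszulB (V : lmodType S) (phi psi : {set 'I_l} -> V) A :
  koszul (fun B => phi B - psi B) A = koszul phi A - koszul psi A.
Proof.
by rewrite /koszul -sumrB; apply: eq_bigr => j _; rewrite scalerBr.
Qed.

Lemma eq_koszul (V : lmodType S) (phi psi : {set 'I_l} -> V) :
  phi =1 psi -> koszul phi =1 koszul psi.
Proof. by move=> E A; apply: eq_bigr => j _; rewrite E. Qed.

(** A cochain with values in the free module whose generators have degrees [s], and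
which has degree [d]: its value at A has degree [d + #|A|]. *)
Definition graded_cochain n (s : 'I_n -> nat) (d : nat)
    (Phi : {set 'I_l} -> 'rV[S]_n) : Prop :=
  forall (A : {set 'I_l}) p, shifted_homog (s p) (d + #|A|) (Phi A 0 p).

Lemma koszul_exact n (s : 'I_n -> nat) d (Phi : {set 'I_l} -> 'rV[S]_n) :
  (forall p, s p < d + l)%N -> graded_cochain s d Phi ->
  (forall A, koszul Phi A = 0) ->
  exists Psi : {set 'I_l} -> 'rV[S]_n,
    graded_cochain s d Psi /\ forall A, Phi A = koszul Psi A.
Proof.
move=> ltsd hPhi Phi0.
have H p : exists psi : {set 'I_l} -> S,
    (forall A : {set 'I_l}, shifted_homog (s p) (d + #|A|) (psi A)) /\
    (forall A, Phi A 0 p = @koszul K l S^o psi A).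
  apply: (koszul_exact_poly (ltsd p)) => A; first exact: hPhi.
  by rewrite -koszul_coord Phi0 mxE.
have [psi Hpsi] := fin_all_exists H.
exists (fun A => \row_p psi p A); split=> [A p|A].
  by rewrite mxE; case: (Hpsi p).
apply/rowP => p; rewrite koszul_coord (Hpsi p).2 !koszul_polyE.
by apply: eq_bigr => j _; rewrite mxE.
Qed.

Lemma koszul_homog n (s : 'I_n -> nat) d (Phi : {set 'I_l} -> 'rV[S]_n) :
  graded_cochain s d Phi -> graded_cochain s d (koszul Phi).
Proof.
move=> hPhi A p; rewrite koszul_coord koszul_polyE.
apply: shifted_homog_sum => j jA; rewrite -mulrA; apply: shifted_homog_sign.
have := hPhi (A :\ j) p => /(@shifted_homogX _ _ _ _ j).
by rewrite -addnS -add1n (_ : (1 + #|A :\ j|)%N = #|A|) // [RHS](cardsD1 j) jA.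
Qed.

(** A map of degree 0 between free modules whose generators have degrees [s] and
[s']. *)
Definition graded_mx m n (s : 'I_m -> nat) (s' : 'I_n -> nat)
    (D : 'M[S]_(m, n)) : Prop :=
  forall p q, shifted_homog (s' q) (s p) (D p q).

Lemma graded_mulmx m n (s : 'I_m -> nat) (s' : 'I_n -> nat) (D : 'M[S]_(m, n)) b
    (w : 'rV[S]_m) :
  graded_mx s s' D -> (forall p, shifted_homog (s p) b (w 0 p)) ->
  forall q, shifted_homog (s' q) b ((w *m D) 0 q).
Proof.
move=> hD hw q; rewrite mxE; apply: shifted_homog_sum => p _.
exact: shifted_homogM (hw p) (hD p q).
Qed.

Lemma shifted_homog_split a b (f : S) : exists g : S,
  shifted_homog a b g /\ forall m, m \in msupp (f - g) -> (mdeg m + a != b)%N.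
Proof.
pose part (P : pred 'X_{1..l}) := \sum_(m <- msupp f | P m) f@_m *: 'X_[m].
have H P m : m \in msupp (part P) -> P m.
  rewrite /part; elim/big_ind: _ m => [m|g h Hg Hh m|m' Pm' m].
  - by rewrite msupp0.
  - by move/msuppD_le; rewrite mem_cat => /orP[/Hg|/Hh].
  - by move/msuppZ_le; rewrite msuppX inE => /eqP->.
exists (part (fun m => mdeg m + a == b)%N); split=> m; first by move/H/eqP.
have E : f = part (fun m => mdeg m + a == b)%N + part (fun m => mdeg m + a != b)%N.
  by rewrite [LHS]mpolyE (bigID (fun m => mdeg m + a == b)%N).
by rewrite [X in X - _]E addrAC subrr add0r => /H.
Qed.

(** Preimages of homogeneous elements may be taken homogeneous. *)
Lemma graded_lift m n (s : 'I_m -> nat) (s' : 'I_n -> nat) (D : 'M[S]_(m, n)) b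
    (v : 'rV[S]_n) (w : 'rV[S]_m) :
  graded_mx s s' D -> (forall q, shifted_homog (s' q) b (v 0 q)) -> v = w *m D ->
  exists w' : 'rV[S]_m,
    (forall p, shifted_homog (s p) b (w' 0 p)) /\ v = w' *m D.
Proof.
move=> hD hv E.
have [g Hg] := fin_all_exists (fun p => shifted_homog_split (s p) b (w 0 p)).
pose w' : 'rV[S]_m := \row_p g p.
have hw' p : shifted_homog (s p) b (w' 0 p) by rewrite mxE; case: (Hg p).
exists w'; split=> //; apply/eqP; rewrite -subr_eq0; apply/eqP/rowP => q.
(* Every monomial of the difference has the right degree, and none has. *)
have h1 : shifted_homog (s' q) b ((v - w' *m D) 0 q).
  rewrite mxE [X in _ + X]mxE; apply: shifted_homogB => //.
  exact: graded_mulmx hD hw' q.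
have h2 u : u \in msupp ((v - w' *m D) 0 q) -> (mdeg u + s' q != b)%N.
  rewrite E -mulmxBl mxE; elim/big_ind: _ u => [u|x y Hx Hy u|p _ u].
  - by rewrite msupp0.
  - by move/msuppD_le; rewrite mem_cat => /orP[/Hx|/Hy].
  - move/msuppM_le/allpairsP=> [[m1 m2] /= [h /hD e ->]].
    rewrite mdegD -addnA e; move: h; rewrite !mxE.
    exact: (Hg p).2.
rewrite [RHS]mxE; apply: msuppnil0; case E': (msupp _) => [//|u us].
have hu : u \in msupp ((v - w' *m D) 0 q) by rewrite E' mem_head.
by have := h2 u hu; rewrite (h1 u hu) eqxx.
Qed.

End KoszulExact.

(** * The socle of S/I above the regularity *)

Section Socle.
Variables (K : fieldType) (l : nat) (F : free_seq K l).
Hypothesis charK0 : [pchar K] =i pred0.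
Local Notation S := {mpoly K[l]}.
Variables (I : S -> Prop) (d : nat).
Hypotheses (gradedF : graded_free_seq F) (resF : resolves I F).
Hypothesis shift_lt : forall i (p : 'I_(rk F i)), (i < l)%N -> (shift p < d + l)%N.

Lemma graded_diff i : graded_mx (@shift _ _ F i.+1) (@shift _ _ F i) (diff F i).
Proof.
move=> p q; have := gradedF.2 i p q; case: leqP => [le /shifted_homogP h m /h|_].
  by rewrite addn0 => ->; rewrite subnK.
by move/eqP->; apply: shifted_homog0.
Qed.

Lemma graded_aug : graded_mx (@shift _ _ F 0) (fun=> 0%N) (aug F).
Proof. by move=> p q; rewrite ord1; apply/shifted_homogP; apply: gradedF.1. Qed.

(** A cochain of degree i + 1 with values in F_i whose coboundary comes from F_(i+1)
is, up to an element coming from F_(i+1), a coboundary. The induction starts at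
i = l - 1, where the coboundary vanishes for lack of subsets with l + 1
elements. *)
Lemma koszul_lift i k (Phi : {set 'I_l} -> 'rV[S]_(rk F i)) :
  (i + k.+1 = l)%N -> graded_cochain (@shift _ _ F i) d Phi ->
  (forall A : {set 'I_l}, #|A| != i.+1 -> Phi A = 0) ->
  (forall A, exists w, koszul Phi A = w *m diff F i) ->
  exists Psi : {set 'I_l} -> 'rV[S]_(rk F i),
    graded_cochain (@shift _ _ F i) d Psi /\
    forall A, exists w, Phi A - koszul Psi A = w *m diff F i.
Proof.
have [_ _ kerD] := resF.
elim: k i Phi => [|k IH] i Phi il hPhi supp imPhi.
  have Phi0 A : koszul Phi A = 0.
    rewrite /koszul big1 // => j jA; rewrite supp ?scaler0 //.
    have := max_card A; rewrite card_ord (cardsD1 j) jA; lia.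
  have lt (p : 'I_(rk F i)) : (shift p < d + l)%N by apply: (@shift_lt i); lia.
  have [Psi [hPsi EPsi]] := koszul_exact charK0 lt hPhi Phi0.
  by exists Psi; split=> // A; exists 0; rewrite mul0mx EPsi subrr.
have hK := koszul_homog hPhi.
have H (A : {set 'I_l}) : exists w : 'rV[S]_(rk F i.+1),
    [/\ forall p, shifted_homog (shift p) (d + #|A|) (w 0 p),
        koszul Phi A = w *m diff F i & #|A| != i.+2 -> w = 0].
  have [cA|cA] := eqVneq #|A| i.+2.
    have [w Ew] := imPhi A.
    have [w' [hw' Ew']] := graded_lift (@graded_diff i) (hK A) Ew.
    by exists w'.
  exists 0; split=> // [p|]; first by rewrite mxE; apply: shifted_homog0.
  rewrite mul0mx /koszul big1 // => j jA; rewrite supp ?scaler0 //.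
  by apply: contra cA => /eqP E; rewrite (cardsD1 j) jA E.
have [Phi' HPhi'] := fin_all_exists H.
have [|A p|A cA|A|Psi' [hPsi' EPsi']] := IH i.+1 Phi'; first by lia.
- by case: (HPhi' A).
- by case: (HPhi' A) => _ _; apply.
- apply/kerD; rewrite koszul_mulmx.
  rewrite -[RHS](koszul_koszul Phi A); apply: eq_koszul => B.
  by case: (HPhi' B).
have lt (p : 'I_(rk F i)) : (shift p < d + l)%N by apply: (@shift_lt i); lia.
have [|A|Psi [hPsi EPsi]] :=
  koszul_exact (Phi := fun A => Phi A - Psi' A *m diff F i) charK0 lt.
- move=> A p; rewrite mxE [X in _ + X]mxE; apply: shifted_homogB => //.
  exact: (graded_mulmx (@graded_diff i) (hPsi' A)).
- rewrite koszulB -koszul_mulmx; case: (HPhi' A) => _ -> _; rewrite -mulmxBl.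
  by apply/kerD.
exists Psi; split=> // A; exists (Psi' A).
by rewrite -EPsi opprB addrC subrK.
Qed.

(** Multiplication by [f] is the cochain [Phi] of degree 0; its coboundary lies in I,
and lifts to F_0. Once [koszul_lift] has corrected [Phi] by elements of I to a
cocycle, this cocycle vanishes because S is a domain. *)
Lemma socle_mem f : (0 < l)%N -> is_ideal I -> f \is d.-homog ->
  (forall j, I ('X_j * f)) -> I f.
Proof.
move=> l_gt0 idealI hf socf; case: (resF) => memI kerA kerD.
pose Phi (A : {set 'I_l}) : 'rV[S]_1 := if A == set0 then const_mx f else 0.
have hPhi : graded_cochain (fun=> 0%N) d Phi.
  move=> A p; rewrite /Phi; case: eqP => [->|_]; rewrite mxE.
    by rewrite cards0 addn0; apply/shifted_homogP.
  exact: shifted_homog0.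
have hK := koszul_homog hPhi.
have H (A : {set 'I_l}) : exists w : 'rV[S]_(rk F 0),
    [/\ forall p, shifted_homog (shift p) (d + #|A|) (w 0 p),
        koszul Phi A = w *m aug F & #|A| != 1%N -> w = 0].
  have [cA|cA] := eqVneq #|A| 1%N.
    have [w Ew] : exists w, koszul Phi A = w *m aug F.
      have /cards1P[j EA] := introT eqP cA.
      have /memI[w Ew] : I (koszul Phi A 0 0).
        rewrite koszul_coord koszul_polyE EA big_set1 -mulrA.
        case: idealI => _ _; apply; rewrite /Phi.
        by rewrite (_ : _ :\ _ = set0) ?eqxx ?mxE // setDv.
      by exists w; apply/rowP => q; rewrite ord1.
    have [w' [hw' Ew']] := graded_lift graded_aug (hK A) Ew.
    by exists w'.
  exists 0; split=> // [p|]; first by rewrite mxE; apply: shifted_homog0.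
  rewrite mul0mx /koszul big1 // => j jA; rewrite /Phi ifN ?scaler0 //.
  by apply: contra cA => /eqP A0; rewrite (cardsD1 j) jA A0 cards0.
have [Phi' HPhi'] := fin_all_exists H.
have [|A p|A cA|A|Psi [_ EPsi]] := @koszul_lift 0 l.-1 Phi'.
- by rewrite prednK.
- by case: (HPhi' A).
- by case: (HPhi' A) => _ _; apply.
- apply/kerA; rewrite koszul_mulmx -[RHS](koszul_koszul Phi A).
  by apply: eq_koszul => B; case: (HPhi' B).
pose j := Ordinal l_gt0.
have : koszul (fun A => Phi A - Psi A *m aug F) [set j] 0 0 = 0.
  rewrite koszulB -koszul_mulmx; case: (HPhi' [set j]) => _ -> _; rewrite -mulmxBl.
  by rewrite (proj2 (kerA _)) ?mxE.
rewrite koszul_coord koszul_polyE big_set1 setDv -mulrA => /eqP.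
rewrite mulf_eq0 mulf_eq0 => /or3P[/eqP s0|/eqP x0|].
- by have := ksign_sqr K j [set j]; rewrite s0 mul0r => /eqP; rewrite eq_sym oner_eq0.
- by have := mcoeffXU K j j; rewrite x0 eqxx mcoeff0 => /eqP; rewrite eq_sym oner_eq0.
rewrite /Phi eqxx mxE [X in _ + X]mxE mxE subr_eq0 => /eqP->.
by apply/memI; exists (Psi set0).
Qed.

End Socle.

(** * Noetherian induction on ideals *)

Section Noether.

Lemma nat_monotone_subseq (s : nat -> nat) : exists phi : nat -> nat,
  {homo phi : i j / (i < j)%N} /\ {homo s \o phi : i j / (i <= j)%N}.
Proof.
have H N : exists n, (N <= n)%N /\ forall k, (N <= k)%N -> (s n <= s k)%N.
  suff [v] : exists v, exists2 n, (N <= n)%N & s n = v.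
    elim/ltn_ind: v => v IH [n Nn sn].
    have [[k [Nk ltk]]|nk] := classic (exists k, (N <= k)%N /\ (s k < s n)%N).
      by apply: (IH (s k)); [rewrite -sn|exists k].
    exists n; split=> // k Nk; rewrite leqNgt; apply/negP => ltk.
    by apply: nk; exists k.
  by exists (s N), N.
pose f N := proj1_sig (constructive_indefinite_description _ (H N)).
have fP N : (N <= f N)%N /\ forall k, (N <= k)%N -> (s (f N) <= s k)%N.
  exact: (proj2_sig (constructive_indefinite_description _ (H N))).
pose phi := fix phi k := if k is k'.+1 then f (phi k').+1 else f 0%N.
have phi_lt k : (phi k < phi k.+1)%N by apply: (fP (phi k).+1).1.
exists phi; split; first exact: (homo_ltn ltn_trans).
apply: (homo_leq (fun i => leqnn _) (fun i j k => @leq_trans _ _ _)) => k.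
change (s (phi k) <= s (phi k.+1))%N.
have E (j : nat) : exists2 N, phi j = f N & (N <= phi j)%N.
  by case: j => [|j]; [exists 0%N|exists (phi j).+1; rewrite //; apply: (fP _).1].
have [N EN Nk] := E k; rewrite {1}EN; apply: (fP N).2.
exact: leq_trans Nk (ltnW (phi_lt k)).
Qed.

(** Dickson's lemma. *)
Lemma dickson n (m : nat -> 'X_{1..n}) :
  exists i j, (i < j)%N /\ (m i <= m j)%MM.
Proof.
suff H k : (k <= n)%N -> exists phi : nat -> nat,
    {homo phi : i j / (i < j)%N} /\ forall c : 'I_n, (c < k)%N ->
    {homo (fun i => m (phi i) c) : i j / (i <= j)%N}.
  have [phi [phi_lt mono]] := H n (leqnn n).
  exists (phi 0%N), (phi 1%N); split; first exact: phi_lt.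
  by apply/mnm_lepP => c; apply: (mono c).
elim: k => [|k IH] kn; first by exists id; split.
have [phi [phi_lt mono]] := IH (ltnW kn).
pose c0 := Ordinal kn.
have [psi [psi_lt psi_mono]] := nat_monotone_subseq (fun i => m (phi i) c0).
have psi_le : {homo psi : i j / (i <= j)%N}.
  by move=> i j; rewrite leq_eqVlt => /orP[/eqP->//|/psi_lt/ltnW].
exists (phi \o psi); split=> [i j ij|c]; first exact/phi_lt/psi_lt.
rewrite ltnS leq_eqVlt => /orP[/eqP ck|ck] i j ij; last exact/mono/psi_le.
by rewrite (_ : c = c0) ?psi_mono //; apply: val_inj.
Qed.

Variables (K : fieldType) (l : nat).
Local Notation S := {mpoly K[l]}.
Implicit Types (J : S -> Prop).

Lemma idealB J f g : is_ideal J -> J f -> J g -> J (f - g).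
Proof. by case=> _ JD JM Jf Jg; apply: JD => //; rewrite -mulN1r; apply: JM. Qed.

Lemma idealZ J (c : K) f : is_ideal J -> J f -> J (c *: f).
Proof. by case=> _ _ JM Jf; rewrite -mul_mpolyC; apply: JM. Qed.

(** If J' strictly contains J, some element of J' outside J has a leading monomial
divisible by no leading monomial of J. *)
Lemma reduced_witness J J' f : is_ideal J -> is_ideal J' ->
  (forall g, J g -> J' g) -> J' f -> ~ J f ->
  exists f', [/\ J' f', ~ J f' &
    forall g, J g -> g != 0 -> ~~ (mlead g <= mlead f')%MM].
Proof.
move=> idJ idJ' sub.
have [m] : exists m, m = mlead f by exists (mlead f).
elim/(@ltmwf l): m f => m IH f Em J'f nJf.
have [[g [Jg nzg le]]|red] :=
  classic (exists g, [/\ J g, g != 0 & (mlead g <= mlead f)%MM]); last first.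
  exists f; split=> // g Jg nzg; apply/negP => le; apply: red; by exists g.
(* one step of division cancels the leading term of f *)
pose q := (mleadc f / mleadc g) *: 'X_[mlead f - mlead g] * g.
have Jq : J q by case: (idJ) => _ _; apply.
have nzf1 : f - q != 0.
  apply/eqP => E; apply: nJf; move/eqP: E; rewrite subr_eq0 => /eqP->//.
have nJf1 : ~ J (f - q).
  by move=> J1; apply: nJf; rewrite -(subrK q f); case: (idJ) => _ JD _; apply: JD.
have nzf : f != 0 by apply: contra_not_neq nJf => ->; case: idJ.
have nzc : mleadc f / mleadc g != 0 by rewrite mulf_neq0 ?invr_eq0 ?mleadc_eq0.
have leadq : mlead q = mlead f.
  rewrite /q -scalerAl mleadZ // mleadM ?mleadXm ?submK //.
  by rewrite -msize_poly_eq0 msizeX.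
have cq : mleadc q = mleadc f.
  have := mleadcM 'X_[mlead f - mlead g] g; rewrite mleadXm submK // => Ec.
  rewrite leadq /q -scalerAl mcoeffZ Ec mcoeffX eqxx mul1r divfK //.
  by rewrite mleadc_eq0.
apply: (IH (mlead (f - q))) => //; last exact: (idealB idJ' J'f (sub _ Jq)).
rewrite Em lt_neqAle; apply/andP; split; last first.
  by have := mleadB_le f q; rewrite leadq joinxx.
apply/negP => /eqP E; have := mleadc_eq0 (f - q).
by rewrite (negPf nzf1) {1}E mcoeffB -{2}leadq cq subrr eqxx.
Qed.

Lemma noetherian_ind (Q : (S -> Prop) -> Prop) :
  (forall J, is_ideal J ->
    (forall J', is_ideal J' -> (forall f, J f -> J' f) ->
       (exists f, J' f /\ ~ J f) -> Q J') -> Q J) ->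
  forall J, is_ideal J -> Q J.
Proof.
move=> step J0 idJ0; apply: NNPP => nQ0.
pose T := {J : S -> Prop | is_ideal J /\ ~ Q J}.
have H (t : T) : exists t' : T, (forall f, sval t f -> sval t' f) /\
    exists f, sval t' f /\ ~ sval t f.
  case: t => J [idJ nQ] /=; apply: NNPP => no; apply: nQ.
  apply: step => // J' idJ' sub ex.
  by apply: NNPP => nQ'; apply: no; exists (exist _ J' (conj idJ' nQ')).
pose next t := sval (constructive_indefinite_description _ (H t)).
have nextP t : (forall f, sval t f -> sval (next t) f) /\
    exists f, sval (next t) f /\ ~ sval t f.
  exact: (proj2_sig (constructive_indefinite_description _ (H t))).
pose J n := sval (iter n next (exist _ J0 (conj idJ0 nQ0))).
have idJ n : is_ideal (J n) by rewrite /J; case: (iter _ _ _) => ? [].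
have JS n f : J n f -> J n.+1 f by apply: (nextP _).1.
have Jsub i j f : (i <= j)%N -> J i f -> J j f.
  move=> /subnK <-; elim: (j - i)%N => // k IH /IH; exact: JS.
have E n : exists f, [/\ J n.+1 f, ~ J n f &
    forall g, J n g -> g != 0 -> ~~ (mlead g <= mlead f)%MM].
  by have [_ [f [J'f nJf]]] := nextP (iter n next (exist _ J0 (conj idJ0 nQ0)));
     apply: (@reduced_witness (J n) (J n.+1) f) => //; apply: JS.
pose f n := sval (constructive_indefinite_description _ (E n)).
have fP n : [/\ J n.+1 (f n), ~ J n (f n) &
    forall g, J n g -> g != 0 -> ~~ (mlead g <= mlead (f n))%MM].
  exact: (proj2_sig (constructive_indefinite_description _ (E n))).
have [i [j [ij le]]] := dickson (fun n => mlead (f n)).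
have [Ji nJi _] := fP i; have [_ _ red] := fP j.
have nz : f i != 0 by apply: contra_not_neq nJi => ->; case: (idJ i).
by have := red _ (Jsub _ _ _ ij Ji) nz; rewrite le.
Qed.
End Noether.

(** * Generic linear forms *)

Lemma subspace_rowspace (K : fieldType) n (U : 'rV[K]_n -> Prop) :
  U 0 -> (forall u v, U u -> U v -> U (u + v)) ->
  (forall c v, U v -> U (c *: v)) ->
  exists A : 'M[K]_n, forall v : 'rV_n, U v <-> (v <= A)%MS.
Proof.
move=> U0 UD UZ.
suff H k (A : 'M[K]_n) : (forall v : 'rV_n, (v <= A)%MS -> U v) ->
    (n - \rank A <= k)%N -> exists A : 'M[K]_n, forall v : 'rV_n, U v <-> (v <= A)%MS.
  by apply: (H n 0); rewrite ?leq_subr // => v; rewrite submx0 => /eqP->.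
elim: k A => [|k IH] A AU lek.
  exists A => v; split=> [_|]; last exact: AU.
  by apply: submx_full; rewrite -col_leq_rank -subn_eq0 -leqn0.
have [[v [Uv nvA]]|all_in] := classic (exists v, U v /\ ~ (v <= A)%MS); last first.
  exists A => v; split=> [Uv|]; last exact: AU.
  by apply: NNPP => nvA; apply: all_in; exists v.
have lt : (A < A + v)%MS.
  by rewrite ltmxE addsmxSl; apply/negP => /(submx_trans (addsmxSr _ _)).
apply: (IH (A + v)%MS) => [w /sub_addsmxP[[u1 u2] /= ->]|].
  apply: UD; first exact/AU/submxMl.
  by rewrite [u2]mx11_scalar mul_scalar_mx; apply: UZ.
have := rank_ltmx lt; lia.
Qed.

(** If L P(0) R = 1 with as many rows as the rank of P(0), then det (L P R) is a
nonzero polynomial, off whose roots P has at least that rank. *)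
Lemma rank_lower_semicontinuous (K : fieldType) a b (P : 'M[{poly K}]_(a, b)) :
  exists2 p : {poly K}, p != 0 & forall t, p.[t] != 0 ->
    (\rank (map_mx (horner_eval 0) P) <= \rank (map_mx (horner_eval t) P))%N.
Proof.
set M0 := map_mx _ P; set r := \rank M0.
have /submxP[L EL] : (row_base M0 <= M0)%MS by rewrite eq_row_base.
pose R := pinvmx (row_base M0).
pose Q := map_mx polyC L *m P *m map_mx polyC R.
have EQ t : map_mx (horner_eval t) Q = L *m map_mx (horner_eval t) P *m R.
  have E m n (B : 'M[K]_(m, n)) : map_mx (horner_eval t) (map_mx polyC B) = B.
    by apply/matrixP => i j; rewrite !mxE /horner_eval hornerC.
  by rewrite !map_mxM !E.
have detQ t : (\det Q).[t] = \det (L *m map_mx (horner_eval t) P *m R).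
  by rewrite -EQ -[LHS]/(horner_eval t _) det_map_mx.
exists (\det Q) => [|t].
  have : (\det Q).[0] != 0.
    rewrite detQ -/M0 -EL mulmxVp ?row_base_free // det1; exact: oner_neq0.
  by apply: contraNneq => ->; rewrite horner0.
rewrite detQ -unitfE -[_ \is a GRing.unit]/(_ \in unitmx) => /mxrank_unit E.
apply: leq_trans (mxrankM_maxr L _); apply: leq_trans (mxrankM_maxl _ R).
by rewrite E.
Qed.

Section GenericNonzerodivisor.
Variables (K : fieldType) (l : nat).
Local Notation S := {mpoly K[l]}.
Implicit Types (J : S -> Prop).

(** Membership in the saturation of [J] with respect to (x_1, ..., x_l). An inductive
definition of it makes uniform exponents unnecessary. *)
Inductive saturation J : S -> Prop :=
| saturation_mem f : J f -> saturation J f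
| saturation_step f : (forall i, saturation J ('X_i * f)) -> saturation J f.

Lemma saturation_mul J f a :
  saturation (fun h => J (h * f)) a -> saturation J (a * f).
Proof.
elim=> {}a IH; [|move=> IHa]; first exact: saturation_mem.
by apply: saturation_step => i; rewrite mulrA.
Qed.

Lemma saturation_add J j h :
  is_ideal J -> J j -> saturation J h -> saturation J (j + h).
Proof.
move=> [_ JD JM] Jj sat; elim: sat j Jj => {}h Jh => [|IH] j Jj.
  exact/saturation_mem/JD.
by apply: saturation_step => i; rewrite mulrDr; apply/IH/JM.
Qed.

(** The value at [t] of the curve with coefficients [y]. It lies in a linear subspace
that misses one of the [y] for finitely many [t] only. *)
Definition moment_form n (y : 'I_n -> S) (t : K) : S := \sum_(j < n) t ^+ j *: y j.

(** For all but finitely many [t], the kernel of the multiplication by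
[moment_form y t] on S/J comes from the saturation of [J]. Besides the variables,
[y] may contain arbitrary polynomials. *)
Lemma generic_nonzerodivisor n (y : 'I_n -> S) J :
  (forall i, exists j, y j = 'X_i) -> is_ideal J ->
  exists2 p : {poly K}, p != 0 & forall t, p.[t] != 0 ->
    forall g, J (moment_form y t * g) -> saturation J g.
Proof.
move=> yX; move: J; apply: noetherian_ind => J idJ IH.
have [J0 JD JM] := idJ.
have [[f [g [nJf nJg Jfg]]]|primeJ] :=
  classic (exists f g, [/\ ~ J f, ~ J g & J (g * f)]).
  (* 0 -> S/(J : f) -> S/J -> S/(J + (f)) -> 0 *)
  pose J1 h := J (h * f); pose J2 h := exists j a, J j /\ h = j + a * f.
  have idJ1 : is_ideal J1.
    split=> [|h k|a h]; rewrite /J1 ?mul0r ?mulrDl -?mulrA //; first exact: JD.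
    exact: JM.
  have idJ2 : is_ideal J2.
    split=> [|_ _ [j [a [Jj ->]]] [k [b [Jk ->]]]|c _ [j [a [Jj ->]]]].
    - by exists 0, 0; split=> //; rewrite mul0r addr0.
    - by exists (j + k), (a + b); split; [exact: JD|ring].
    - by exists (c * j), (c * a); split; [exact: JM|ring].
  have [|||p1 nz1 P1] := IH J1 => //.
    by move=> h Jh; rewrite /J1 mulrC; apply: JM.
    by exists g.
  have [|||p2 nz2 P2] := IH J2 => //.
    by move=> h Jh; exists h, 0; split; rewrite // mul0r addr0.
    by exists f; split=> //; exists 0, 1; split; rewrite // mul1r add0r.
  exists (p1 * p2) => [|t]; first exact: mulf_neq0.
  rewrite hornerM mulf_eq0 negb_or => /andP[/P1 {}P1 /P2 {}P2] h Jh.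
  have /P2 : J2 (moment_form y t * h).
    by exists (moment_form y t * h), 0; rewrite mul0r addr0.
  move=> sat2; elim: sat2 Jh => [_ [j [a [Jj ->]]]|{}h _ IHh] Jh.
    have /P1 : J1 (moment_form y t * a).
      rewrite /J1; have := idealB idJ Jh (JM (moment_form y t) j Jj).
      by rewrite -mulrBr addrAC subrr add0r mulrA.
    by move/saturation_mul; apply: saturation_add.
  by apply: saturation_step => i; apply: IHh; rewrite mulrCA; apply: JM.
have prime f g : J (g * f) -> J f \/ J g.
  move=> Jgf; apply: NNPP => no; apply: primeJ; exists f, g.
  by split=> // ?; apply: no; [left|right].
have [allX|] := classic (forall i, J 'X_i).
  exists 1 => [|t _ g _]; first exact: oner_neq0.
  by apply: saturation_step => i; apply: saturation_mem; rewrite mulrC; apply: JM.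
move/not_all_ex_not => [i nJi]; have [j0 Ej0] := yX i.
(* The combinations of the y_j in J are orthogonal to some vector, column q of the
   cokernel, whose entry at j0 is nonzero; pairing that vector with the powers of
   t gives the polynomial sought. *)
pose U (c : 'rV[K]_n) := J (\sum_j c 0 j *: y j).
have [|u v Uu Uv|c v Uv|A HA] := @subspace_rowspace K n U.
- by rewrite /U big1 // => j _; rewrite mxE scale0r.
- rewrite /U (eq_bigr (fun j => u 0 j *: y j + v 0 j *: y j)) => [|j _].
    by rewrite big_split; apply: JD.
  by rewrite mxE scalerDl.
- rewrite /U (eq_bigr (fun j => c *: (v 0 j *: y j))) => [|j _].
    by rewrite -scaler_sumr; apply: idealZ.
  by rewrite mxE scalerA.
have /negP : ~ ((delta_mx 0 j0 : 'rV[K]_n) <= A)%MS.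
  move/HA; rewrite /U (bigD1 j0) //= mxE !eqxx scale1r Ej0 big1 ?addr0 // => j nj.
  by rewrite mxE eqxx (negPf nj) scale0r.
rewrite submxE -rowE => /rV0Pn[q]; rewrite mxE => nzq.
pose p := \sum_j cokermx A j q *: 'X^j.
exists p => [|t nz g].
  apply: contra_neq nzq => p0; have := congr1 (fun r : {poly K} => r`_j0) p0.
  rewrite /= coef0 coef_sum (bigD1 j0) //= coefZ coefXn eqxx mulr1 big1 ?addr0 //.
  by move=> j nj; rewrite coefZ coefXn eq_sym val_eqE (negPf nj) mulr0.
rewrite mulrC => /prime[Jt|Jg]; last exact: saturation_mem.
suff E0 : p.[t] = 0 by rewrite E0 eqxx in nz.
have /HA : U (\row_j t ^+ j).
  by rewrite /U (eq_bigr (fun j : 'I_n => t ^+ j *: y j)) // => j _; rewrite mxE.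
rewrite submxE => /eqP/rowP/(_ q); rewrite !mxE => E.
rewrite horner_sum -[RHS]E; apply: eq_bigr => j _.
by rewrite hornerZ hornerXn mulrC; congr (_ * _); rewrite mxE.
Qed.
End GenericNonzerodivisor.

(** * Full rank in a given degree *)

Section FullRank.
Variables (K : fieldType) (l : nat).
Local Notation S := {mpoly K[l]}.
Implicit Types (I : S -> Prop) (f g q : S).

(** The monomials of degree [i], the basis on which forms of degree [i] are written
as row vectors. *)
Definition monomials (i : nat) : seq 'X_{1..l} :=
  map val [seq m <- enum {: 'X_{1..l < i.+1}} | mdeg (val m) == i].

Lemma mem_monomials i m : (m \in monomials i) = (mdeg m == i).
Proof.
apply/mapP/idP => [[b]|/eqP di]; first by rewrite mem_filter => /andP[? _] ->.
have lt : (mdeg m < i.+1)%N by rewrite di.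
by exists (BMultinom lt); rewrite // mem_filter /= di eqxx mem_enum.
Qed.

Lemma monomials_uniq i : uniq (monomials i).
Proof. by rewrite (map_inj_uniq val_inj) filter_uniq ?enum_uniq. Qed.

Definition row_of_form i f : 'rV[K]_(size (monomials i)) :=
  \row_k f@_(nth 0%MM (monomials i) k).

Definition form_of_row i (v : 'rV[K]_(size (monomials i))) : S :=
  \sum_(k < size (monomials i)) v 0 k *: 'X_[nth 0%MM (monomials i) k].

Lemma form_of_row_homog i v : @form_of_row i v \is i.-homog.
Proof.
apply: rpred_sum => k _; apply: rpredZ; rewrite dhomogX /=.
by rewrite -mem_monomials mem_nth.
Qed.

Lemma row_of_formK i f : f \is i.-homog -> form_of_row (row_of_form i f) = f.
Proof.
move=> /dhomogP hf; rewrite /form_of_row.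
under eq_bigr do rewrite mxE.
rewrite -(big_mkord xpredT (fun k => f@_(nth 0%MM (monomials i) k) *:
  'X_[nth 0%MM (monomials i) k])).
rewrite -(big_nth 0%MM xpredT (fun m => f@_m *: 'X_[m])).
apply/mpolyP => m; rewrite linear_sum /=.
under eq_bigr do rewrite mcoeffZ mcoeffX.
have [mi|mi] := boolP (m \in monomials i).
  rewrite (bigD1_seq m) ?monomials_uniq //= eqxx mulr1 big1 ?addr0 // => m' nm.
  by rewrite (negPf nm) mulr0.
rewrite big_seq big1 => [|m' m'i].
  apply/esym/eqP; rewrite mcoeff_eq0; apply: contra mi => /hf /= <-.
  by rewrite mem_monomials.
by rewrite (_ : m' == m = false) ?mulr0 //; apply: contraNF mi => /eqP<-.
Qed.

Lemma form_of_rowD i u v :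
  @form_of_row i (u + v) = form_of_row u + form_of_row v.
Proof.
by rewrite -big_split; apply: eq_bigr => k _; rewrite mxE scalerDl.
Qed.

Lemma form_of_rowZ i c v : @form_of_row i (c *: v) = c *: form_of_row v.
Proof.
by rewrite /form_of_row scaler_sumr; apply: eq_bigr => k _; rewrite mxE scalerA.
Qed.

Lemma form_of_rowB i u v :
  @form_of_row i (u - v) = form_of_row u - form_of_row v.
Proof. by rewrite form_of_rowD -scaleN1r form_of_rowZ scaleN1r. Qed.

Lemma form_of_row0 i : @form_of_row i 0 = 0.
Proof. by rewrite -[0 in LHS](subrr 0) form_of_rowB subrr. Qed.

(** The matrix of the multiplication by the linear form [q] from degree [i] to degree
[i.+1]. *)
Definition mul_mx i q : 'M[K]_(size (monomials i), size (monomials i.+1)) :=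
  \matrix_(k, k') (q * 'X_[nth 0%MM (monomials i) k])@_(nth 0%MM (monomials i.+1) k').

Lemma form_of_row_mul i q v : q \is 1.-homog ->
  form_of_row (v *m mul_mx i q) = q * form_of_row v.
Proof.
move=> hq; rewrite -[RHS](@row_of_formK i.+1); last first.
  by rewrite -add1n; apply: dhomogM hq (form_of_row_homog v).
congr form_of_row; apply/rowP => k'; rewrite !mxE mulr_sumr linear_sum /=.
by apply: eq_bigr => k _; rewrite -scalerAr mcoeffZ mxE.
Qed.

Lemma ideal_rowspace I i : is_ideal I ->
  exists A : 'M[K]_(size (monomials i)),
  forall v, I (form_of_row v) <-> (v <= A)%MS.
Proof.
move=> idI; apply: subspace_rowspace => [|u v Iu Iv|c v Iv].
- by rewrite form_of_row0; case: idI.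
- by rewrite form_of_rowD; case: idI => _ ID _; apply: ID.
- by rewrite form_of_rowZ; apply: idealZ.
Qed.

(** Whether [q] has full rank in degree [i] depends only on the rank of its
multiplication matrix modulo the ideal, and higher ranks are better. *)
Lemma full_rank_mxrank I i : is_ideal I ->
  exists C : 'M[K]_(size (monomials i.+1)), forall q q',
    q \is 1.-homog -> q' \is 1.-homog ->
    (\rank (mul_mx i q *m C) <= \rank (mul_mx i q' *m C))%N ->
    mul_full_rank I q i -> mul_full_rank I q' i.
Proof.
move=> idI; have [I0 ID IM] := idI.
have [A HA] := ideal_rowspace i idI; have [A' HA'] := ideal_rowspace i.+1 idI.
exists (cokermx A') => q q' hq hq' le_rk.
set C := cokermx A' in le_rk *.
have kerP p v : p \is 1.-homog ->
    v *m (mul_mx i p *m C) = 0 <-> I (p * form_of_row v).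
  move=> hp; rewrite mulmxA -form_of_row_mul // HA' submxE.
  by split=> [->//|/eqP].
have subA p : p \is 1.-homog -> (A <= kermx (mul_mx i p *m C))%MS.
  move=> hp; apply/row_subP => k; apply/sub_kermxP/kerP => //.
  by apply/IM/HA/row_sub.
case=> [inj|surj]; [left|right].
- have kerA : (kermx (mul_mx i q *m C) <= A)%MS.
    apply/row_subP => k; set v := row k _.
    have /kerP-/(_ hq) Iv : v *m (mul_mx i q *m C) = 0.
      by apply/sub_kermxP/row_sub.
    have := inj _ 0 (form_of_row_homog v) (dhomog0 _ _ _).
    by rewrite /eq_mod_ideal mulr0 !subr0 => /(_ Iv)/HA.
  have : (kermx (mul_mx i q' *m C) <= A)%MS.
    rewrite -(geq_leqif (mxrank_leqif_sup (subA _ hq'))) mxrank_ker.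
    by have := mxrankS kerA; rewrite mxrank_ker; apply: leq_trans; apply: leq_sub2l.
  move=> ker'A f g hf hg; rewrite /eq_mod_ideal -mulrBr => Ifg.
  have hfg : f - g \is i.-homog by apply: rpredB.
  rewrite -(row_of_formK hfg); apply/HA/(submx_trans _ ker'A)/sub_kermxP/kerP => //.
  by rewrite row_of_formK.
have subC : (C <= mul_mx i q *m C)%MS.
  apply/row_subP => k; rewrite rowE; set w := delta_mx _ _.
  have [f hf If] := surj _ (form_of_row_homog w).
  have : (row_of_form i f *m mul_mx i q - w <= A')%MS.
    by apply/HA'; rewrite form_of_rowB form_of_row_mul ?row_of_formK.
  rewrite submxE mulmxBl subr_eq0 -mulmxA => /eqP <-; exact: submxMl.
have subC' : (C <= mul_mx i q' *m C)%MS.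
  rewrite -(geq_leqif (mxrank_leqif_sup (submxMl _ _))).
  exact: leq_trans (mxrankS subC) le_rk.
move=> h hh.
have /submxP[v Ev] : (row_of_form i.+1 h *m C <= mul_mx i q' *m C)%MS.
  exact: submx_trans (submxMl _ _) subC'.
exists (form_of_row v); first exact: form_of_row_homog.
rewrite /eq_mod_ideal -form_of_row_mul // -{1}(row_of_formK hh) -form_of_rowB.
by apply/HA'; rewrite submxE mulmxBl subr_eq0 -mulmxA -Ev.
Qed.

Lemma moment_form_homog n (y : 'I_n -> S) t :
  (forall j, y j \is 1.-homog) -> moment_form y t \is 1.-homog.
Proof. by move=> hy; apply: rpred_sum => j _; apply: rpredZ. Qed.

Lemma generic_full_rank I i n (y : 'I_n -> S) : is_ideal I ->
  (forall j, y j \is 1.-homog) -> mul_full_rank I (moment_form y 0) i ->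
  exists2 p : {poly K}, p != 0 &
    forall t, p.[t] != 0 -> mul_full_rank I (moment_form y t) i.
Proof.
move=> idI hy full0; have [C HC] := full_rank_mxrank i idI.
pose P := \sum_(j < n) 'X^j *: map_mx polyC (mul_mx i (y j) *m C).
have EP t : map_mx (horner_eval t) P = mul_mx i (moment_form y t) *m C.
  have -> : mul_mx i (moment_form y t) = \sum_(j < n) t ^+ j *: mul_mx i (y j).
    apply/matrixP => k k'; rewrite summxE !mxE mulr_suml linear_sum /=.
    by apply: eq_bigr => j _; rewrite !mxE -scalerAl mcoeffZ.
  rewrite mulmx_suml; apply/matrixP => k k'; rewrite mxE !summxE /horner_eval.
  rewrite horner_sum; apply: eq_bigr => j _; rewrite -scalemxAl.
  by rewrite mxE [X in _ * X]mxE hornerM hornerXn hornerC [RHS]mxE.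
have [p nzp Hp] := rank_lower_semicontinuous P.
exists p => // t /Hp; rewrite !EP => le_rk.
by apply: HC full0 => //; apply: moment_form_homog.
Qed.

(** An ideal without socle in degrees at least [e] agrees with its saturation there. *)
Lemma saturation_socle I e :
  (forall d f, (e <= d)%N -> f \is d.-homog -> (forall i, I ('X_i * f)) -> I f) ->
  forall f, saturation I f -> forall d, (e <= d)%N -> f \is d.-homog -> I f.
Proof.
move=> soc f; elim=> // {}f _ IH d ed hf; apply: (soc d) => // i.
apply: (IH i d.+1); first exact: leqW.
by rewrite -add1n; apply: dhomogM hf; rewrite dhomogX /= mdeg1.
Qed.

End FullRank.

(** * Finitely many degrees suffice *)

Lemma pchar0_nonroot (K : fieldType) (p : {poly K}) :
  [pchar K] =i pred0 -> p != 0 -> exists t, p.[t] != 0.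
Proof.
move=> charK0 nzp; apply: NNPP => no.
pose rs : seq K := [seq n%:R | n <- iota 0 (size p)].
have : (size rs < size p)%N.
  apply: max_poly_roots nzp _ _.
    by apply/allP => t _; rewrite /root; apply/negPn/negP => nz; apply: no; exists t.
  rewrite map_inj_uniq ?iota_uniq // => a b.
  wlog le : a b / (a <= b)%N => [W E|E].
    by case: (leqP a b) => [|/ltnW] le; [apply: W|apply/esym/W].
  apply/eqP; rewrite eqn_leq le /= -subn_eq0 -(proj1 (pcharf0P _) charK0).
  by rewrite natrB // E subrr.
by rewrite size_map size_iota ltnn.
Qed.

Section Regularity.
Variables (K : fieldType) (l : nat) (I : {mpoly K[l]} -> Prop).
Hypothesis (charK0 : [pchar K] =i pred0).

Lemma shift_max_degree (F : free_seq K l) i (p : 'I_(rk F i)) :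
  exists2 d, is_max_degree F i d & (shift p <= d)%N.
Proof.
exists (\max_(q < rk F i) shift q)%N; last exact: (leq_bigmax p).
split=> [|j /eqP]; rewrite /betti -?lt0n.
  have [|q Eq] := @bigop.eq_bigmax _ (@shift _ _ F i).
    by apply/card_gt0P; exists p.
  by apply/eqP; rewrite -lt0n; apply/card_gt0P; exists q; rewrite inE Eq.
by move=> /card_gt0P[q]; rewrite inE => /eqP<-; apply: (leq_bigmax q).
Qed.

(** The quotient S/I has no socle in the degrees [d >= reg(I)]. *)
Lemma regularity_socle (r : option int) d f : (0 < l)%N -> is_ideal I ->
  regularity I r -> ~ le_reg_pred d r -> f \is d.-homog ->
  (forall i, I ('X_i * f)) -> I f.
Proof.
move=> l_gt0 idI [F [gradedF resF _] regF] nle hf.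
apply: (@socle_mem _ _ F charK0 I d) => // i p il.
have [e maxe le_e] := shift_max_degree p.
case: r regF nle => [m [_ le_m]|no _]; last by have := no _ _ maxe.
by have := le_m _ _ maxe; rewrite /=; lia.
Qed.
End Regularity.

Theorem theorem4p3 (K : fieldType) (charK0 : [pchar K] =i pred0) (l : nat)
    (I : {mpoly K[l]} -> Prop) (homI : is_homogeneous_ideal I)
    (r : option int) (regI : regularity I r) :
  weak_lefschetz I <->
  exists2 ell : {mpoly K[l]}, ell \is 1.-homog &
    forall i : nat, le_reg_pred i r -> mul_full_rank I ell i.
Proof.
split=> [[ell hell full]|[ell hell full]]; first by exists ell.
have [idI _] := homI; have [I0 _ _] := idI.
have [l0|l_gt0] := posnP l.
  (* Without variables there is no nonzero form of positive degree. *)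
  exists ell => // i; right=> h hh; exists 0; first exact: dhomog0.
  suff -> : h = 0 by rewrite /eq_mod_ideal mulr0 subrr.
  apply: msuppnil0; case E: (msupp h) => [//|u us].
  have /(dhomogP _ _ _ hh) : u \in msupp h by rewrite E mem_head.
  rewrite /= mdegE big1 // => j; have lt := leq_ltn_trans (leq0n j) (ltn_ord j).
  by rewrite l0 in lt.
(* The curve with coefficients ell, x_1, ..., x_l passes through ell at t = 0. *)
pose y (j : 'I_l.+1) : {mpoly K[l]} := if unlift ord0 j is Some i then 'X_i else ell.
have hy j : y j \is 1.-homog.
  by rewrite /y; case: unlift => // i; rewrite dhomogX /= mdeg1.
have y0 : moment_form y 0 = ell.
  rewrite /moment_form big_ord_recl big1 => [|j _]; last by rewrite expr0n scale0r.
  by rewrite addr0 expr0 scale1r /y unlift_none.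
have yX i : exists j, y j = 'X_i by exists (lift ord0 i); rewrite /y liftK.
have [p nzp Hp] := generic_nonzerodivisor yX idI.
pose N := if r is Some m then `|m|%N else 0%N.
have [p' nzp' Hp'] : exists2 p' : {poly K}, p' != 0 & forall t, p'.[t] != 0 ->
    forall i, (i < N)%N -> le_reg_pred i r -> mul_full_rank I (moment_form y t) i.
  elim: N => [|n [p' nzp' Hp']]; first by exists 1; rewrite ?oner_neq0.
  have [le_n|nle] := classic (le_reg_pred n r); last first.
    exists p' => // t /Hp' H i; rewrite ltnS leq_eqVlt => /orP[/eqP->//|]; exact: H.
  have [|p2 nz2 Hp2] := @generic_full_rank K l I n _ y idI hy.
    by rewrite y0; apply: full.
  exists (p' * p2) => [|t]; first exact: mulf_neq0.
  rewrite hornerM mulf_eq0 negb_or => /andP[/Hp' H /Hp2 H2] i.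
  by rewrite ltnS leq_eqVlt => /orP[/eqP->//|]; apply: H.
have [t] := pchar0_nonroot charK0 (mulf_neq0 nzp nzp').
rewrite hornerM mulf_eq0 negb_or => /andP[/Hp {}Hp /Hp' {}Hp'].
exists (moment_form y t) => [|i]; first exact: moment_form_homog.
have [le_i|nle_i] := classic (le_reg_pred i r).
  apply: Hp' => //; rewrite /N; case: (r) le_i => //= m; lia.
left=> f g hf hg; rewrite /eq_mod_ideal -mulrBr => /Hp sat.
apply: (saturation_socle (e := i) _ sat (leqnn i)); last exact: rpredB.
move=> d h le_id; apply: (regularity_socle charK0 l_gt0 idI regI).
by move=> le_d; apply: nle_i; case: (r) le_d => //= m; lia.
Qed.
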